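(* Let $x^0\in X$, $\beta\in(0,1)$, $B\ge k$ and $\widehat\rho_1\ge\mu^*$. For every $0<\varepsilon<f(x^0)-f^*$, the restarted limited-memory proximal bundle method (rLM-PBM) with inputs $x^0,\widehat\rho_1,\beta,B$ produces a center $\bar x$ satisfying $f(\bar x)-f^*\le\varepsilon$ after at most $$O\left(B\left(1+\frac L{\mu^*}\right)\left[1+\log_+\frac{\|g(x^0)\|^2}{\mu^*\varepsilon}\right]+B\log_+\frac{\widehat\rho_1}{\mu^*}\right)$$ first-order oracle calls.
   Context: Setting. $X\subseteq\mathbb R^n$ is a nonempty closed convex set, $f:X\to\mathbb R$ is convex, lower semicontinuous and attains its minimum $f^*=\min_{X}f$; $X^*=\operatorname{argmin}_X f$. $\|\cdot\|$, $\langle\cdot,\cdot\rangle$ are the Euclidean norm and inner product; $\log_+(a):=\log(\max\{1,a\})$ for $a\ge0$. For $x\in X$, $\partial f(x)=\{v\in\mathbb R^n: f(z)\ge f(x)+\langle v,z-x\rangle\ \forall z\in X\}$. A first-order oracle returns, at any $u\in X$, $f(u)$ and a subgradient $g(u)\in\partial f(u)$; $\ell_f(x;u):=f(u)+\langle g(u),x-u\rangle$. Piecewise smoothness. $k\in\mathbb N_+$, $L>0$, and $f$ is $(k,L)$-piecewise smooth: there are $k$ subsets $X_1,\dots,X_k$ of $X$ covering $X$ such that each restriction $f|_{X_i}$ is $L$-smooth; this is used together with the oracle assumption that $f(x)-\ell_f(x;\bar x)\le\frac L2\|x-\bar x\|^2$ for all $i\in\{1,\dots,k\}$ and all $x,\bar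 x\in X_i$. Quadratic growth. $\mu^*:=\sup\{\nu>0: f(x)-f^*\ge\frac\nu2\operatorname{dist}^2(x,X^* )\ \forall x\in X\}$, and $0<\mu^*<\infty$ is assumed. Certificate value. For a finite-valued lower semicontinuous convex $\psi:X\to\mathbb R$ with $\psi\le f$ on $X$, $\rho>0$ and $\bar x\in X$, $\Delta_\rho(\bar x;\psi):=\max_{x\in X}\{f(\bar x)-\psi(x)-\frac\rho2\|x-\bar x\|^2\}$. One-Step (with parameters $\rho,\beta,B$), applied to center $z^t$, model $\psi^t$, counter $b$ and best value $\bar f$: compute $y^t=\operatorname{argmin}_{x\in X}\{\psi^t(x)+\frac\rho2\|x-z^t\|^2\}$, $\Delta_t=f(z^t)-\psi^t(y^t)-\frac\rho2\|z^t-y^t\|^2$, and update $\bar f\leftarrow\min\{\bar f,f(y^t)\}$. If $f(z^t)-f(y^t)\ge\beta(f(z^t)-\psi^t(y^t))$, the iteration is serious and $z^{t+1}=y^t$; otherwise it is null and $z^{t+1}=z^t$. Let $a^t(x)=\psi^t(y^t)+\rho\langle z^t-y^t,x-y^t\rangle$. If the iteration is serious or $b=B$, set $\psi^{t+1}(x)=\max\{a^t(x),\ell_f(x;z^{t+1}),\ell_f(x;y^t)\}$ and $b\leftarrow0$; otherwise $\psi^{t+1}(x)=\max\{\psi^t(x),\ell_f(x;y^t)\}$ and $b\leftarrow b+1$. rLM-PBM. Input $x^0\in X$, $\widehat\rho_1>0$, $\beta\in(0,1)$, bundle size $B\ge k$. Initialize $\bar x=x^0$, $\bar\psi=\ell_f(\cdot;x^0)$,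 $\bar\Delta=\Delta_{\widehat\rho_1}(\bar x;\bar\psi)$, $\bar f=f(x^0)$, $\underline f=f(\bar x)-4\bar\Delta$. For stages $s=1,2,\dots$: set $z^0=\bar x$, $\psi^0=\bar\psi$, $b=0$. Inner loop, $t=0,1,2,\dots$: run One-Step with $\rho=\widehat\rho_s$; if $\bar f<\underline f$, exit the inner loop; otherwise, if $\Delta_t\le\bar\Delta/2$, update $\bar x\leftarrow z^t$, $\bar\psi(x)\leftarrow\max\{a^t(x),\ell_f(x;z^t),\ell_f(x;y^t)\}$, $\bar\Delta\leftarrow\Delta_t$ and exit the inner loop. After the inner loop, let $i\ge0$ be the smallest integer with $f(\bar x)-4\cdot2^i\bar\Delta\le\bar f$ and set $\widehat\rho_{s+1}=\widehat\rho_s/2^i$, $\bar\Delta\leftarrow2^i\bar\Delta$, $\underline f\leftarrow f(\bar x)-4\bar\Delta$. The oracle is called once at $x^0$ and once at each trial point $y^t$. $O(\cdot)$ hides a constant depending only on $\beta$. *)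

(* Defs.v *)
From HB Require Import structures.
From mathcomp Require Import all_boot all_order all_algebra.
From mathcomp Require Import all_classical all_reals all_analysis.

Set Implicit Arguments.
Unset Strict Implicit.
Unset Printing Implicit Defensive.

Import Order.TTheory GRing.Theory Num.Theory.
Import numFieldNormedType.Exports.

Local Open Scope classical_set_scope.
Local Open Scope ring_scope.

(* The library norm on ['rV[R]_n] is the sup norm, hence [enorm]. The topology
   is the same, so [closed], [nbhs] and [subspace] are used from the library. *)
Definition dot (R : realType) (n : nat) (u v : 'rV[R]_n) : R :=
  \sum_(i < n) u 0 i * v 0 i.

Definition enorm (R : realType) (n : nat) (u : 'rV[R]_n) : R :=
  Num.sqrt (dot u u).

Definition edist_to (R : realType) (n : nat) (x : 'rV[R]_n)
    (A : set 'rV[R]_n) : R :=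
  inf [set enorm (x - a) | a in A].

Definition log_plus (R : realType) (a : R) : R := ln (Num.max 1 a).

(* A function f : X -> R is given by a total function whose values outside X
   are irrelevant: every condition below only involves its values on X. *)

(* Lower semicontinuity for the topology induced on X (in [subspace X] the
   points outside X are isolated and impose no condition). *)
Definition lsc_on (R : realType) (n : nat) (X : set 'rV[R]_n)
    (f : 'rV[R]_n -> R) : Prop :=
  lower_semicontinuous (fun x : subspace X => (f x)%:E).

Definition argmin_on (R : realType) (n : nat) (X : set 'rV[R]_n)
    (f : 'rV[R]_n -> R) : set 'rV[R]_n :=
  [set x | X x /\ forall y, X y -> f x <= f y].

Definition min_value (R : realType) (n : nat) (X : set 'rV[R]_n)
    (f : 'rV[R]_n -> R) : R :=
  inf [set f x | x in X].

Definition subdifferential (R : realType) (n : nat) (X : set 'rV[R]_n)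
    (f : 'rV[R]_n -> R) (x : 'rV[R]_n) : set 'rV[R]_n :=
  [set v | forall y, X y -> f x + dot v (y - x) <= f y].

(* [linearization f g u x] is l_f(x; u), with g the oracle's subgradient. *)
Definition linearization (R : realType) (n : nat) (f : 'rV[R]_n -> R)
    (g : 'rV[R]_n -> 'rV[R]_n) (u x : 'rV[R]_n) : R :=
  f u + dot (g u) (x - u).

(* The restriction of f to S is differentiable relative to S, with an
   L-Lipschitz gradient. As S is arbitrary, relative gradients need not be
   unique; one Lipschitz choice of them is required. *)
Definition L_smooth_on (R : realType) (n : nat) (S : set 'rV[R]_n) (L : R)
    (f : 'rV[R]_n -> R) : Prop :=
  exists G : 'rV[R]_n -> 'rV[R]_n,
    (forall x, S x -> forall e : R, 0 < e ->
       \forall y \near within S (nbhs x),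
         `|f y - f x - dot (G x) (y - x)| <= e * enorm (y - x)) /\
    (forall x y, S x -> S y -> enorm (G x - G y) <= L * enorm (x - y)).

(* (k, L)-piecewise smoothness of f on X, witnessed by the pieces P. *)
Definition piecewise_smooth (R : realType) (n k : nat) (X : set 'rV[R]_n)
    (L : R) (P : 'I_k -> set 'rV[R]_n) (f : 'rV[R]_n -> R) : Prop :=
  \bigcup_i P i = X /\ forall i, L_smooth_on (P i) L f.

Definition piecewise_oracle_bound (R : realType) (n k : nat) (L : R)
    (P : 'I_k -> set 'rV[R]_n) (f : 'rV[R]_n -> R)
    (g : 'rV[R]_n -> 'rV[R]_n) : Prop :=
  forall i x xb, P i x -> P i xb ->
    f x - linearization f g xb x <= L / 2 * enorm (x - xb) ^+ 2.

(* Extended-real supremum: -oo when no nu > 0 is admissible, +oo when the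
   admissible nu are unbounded. *)
Definition growth_modulus (R : realType) (n : nat) (X : set 'rV[R]_n)
    (f : 'rV[R]_n -> R) : \bar R :=
  ereal_sup [set nu%:E | nu in [set nu : R | 0 < nu /\
    forall x, X x ->
      nu / 2 * edist_to x (argmin_on X f) ^+ 2 <= f x - min_value X f]].

Definition certificate (R : realType) (n : nat) (X : set 'rV[R]_n)
    (f : 'rV[R]_n -> R) (rho : R) (xb : 'rV[R]_n) (psi : 'rV[R]_n -> R) : R :=
  sup [set f xb - psi x - rho / 2 * enorm (x - xb) ^+ 2 | x in X].

(* The argmin is a single point for the models built by the method, so the
   choice is immaterial; z is only a default in case there is no minimizer. *)
Definition prox_point (R : realType) (n : nat) (X : set 'rV[R]_n) (rho : R)
    (psi : 'rV[R]_n -> R) (z : 'rV[R]_n) : 'rV[R]_n :=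
  xget z (argmin_on X (fun x => psi x + rho / 2 * enorm (x - z) ^+ 2)).

Record step_result (R : realType) (n : nat) := StepResult {
  trial_point : 'rV[R]_n;            (* y^t *)
  step_gap : R;                      (* Delta_t *)
  step_cut : 'rV[R]_n -> R;          (* a^t *)
  step_best : R;                     (* updated best value *)
  next_center : 'rV[R]_n;            (* z^(t+1) *)
  next_model : 'rV[R]_n -> R;        (* psi^(t+1) *)
  next_counter : nat }.              (* updated b *)

Definition one_step (R : realType) (n : nat) (X : set 'rV[R]_n)
    (f : 'rV[R]_n -> R) (g : 'rV[R]_n -> 'rV[R]_n) (rho beta : R) (B : nat)
    (z : 'rV[R]_n) (psi : 'rV[R]_n -> R) (b : nat) (best : R) :
    step_result R n :=
  let y := prox_point X rho psi z in
  let gap := f z - psi y - rho / 2 * enorm (z - y) ^+ 2 in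
  let cut x := psi y + rho * dot (z - y) (x - y) in
  let serious := beta * (f z - psi y) <= f z - f y in
  let z' := if serious then y else z in
  let reset := serious || (b == B) in
  let psi' x :=
    if reset then
      Num.max (cut x)
        (Num.max (linearization f g z' x) (linearization f g y x))
    else Num.max (psi x) (linearization f g y x) in
  StepResult y gap cut (Num.min best (f y)) z' psi'
    (if reset then 0%N else b.+1).

(* State of the method between two calls of [one_step]. *)
Record rlm_state (R : realType) (n : nat) := RlmState {
  st_xbar : 'rV[R]_n;
  st_psibar : 'rV[R]_n -> R;
  st_gapbar : R;                     (* \bar Delta *)
  st_best : R;                       (* \bar f *)
  st_low : R;                        (* \underline f *)
  st_rho : R;                        (* \hat rho_s *)
  st_z : 'rV[R]_n;
  st_psi : 'rV[R]_n -> R;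
  st_counter : nat;
  st_calls : nat }.                  (* oracle calls made so far *)

Definition rlm_init (R : realType) (n : nat) (X : set 'rV[R]_n)
    (f : 'rV[R]_n -> R) (g : 'rV[R]_n -> 'rV[R]_n) (x0 : 'rV[R]_n) (rho1 : R) :
    rlm_state R n :=
  let psi := linearization f g x0 in
  let gap := certificate X f rho1 x0 psi in
  {| st_xbar := x0; st_psibar := psi; st_gapbar := gap; st_best := f x0;
     st_low := f x0 - 4 * gap; st_rho := rho1;
     st_z := x0; st_psi := psi; st_counter := 0; st_calls := 1 |}.

(* The smallest i with f(xb) - 4 * 2^i * gap <= best. *)
Definition doubling_exponent (R : realType) (n : nat) (f : 'rV[R]_n -> R)
    (xb : 'rV[R]_n) (gap best : R) : nat :=
  xget 0%N [set i | f xb - 4 * 2 ^+ i * gap <= best /\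
    forall j, f xb - 4 * 2 ^+ j * gap <= best -> (i <= j)%N].

(* End of an inner loop with the given values of xbar, psibar, \bar Delta,
   \bar f and \hat rho_s, followed by the start of the next stage. *)
Definition next_stage (R : realType) (n : nat) (f : 'rV[R]_n -> R)
    (xb : 'rV[R]_n) (psib : 'rV[R]_n -> R) (gap best rho : R) (calls : nat) :
    rlm_state R n :=
  let i := doubling_exponent f xb gap best in
  let gap' := 2 ^+ i * gap in
  {| st_xbar := xb; st_psibar := psib; st_gapbar := gap'; st_best := best;
     st_low := f xb - 4 * gap'; st_rho := rho / 2 ^+ i;
     st_z := xb; st_psi := psib; st_counter := 0; st_calls := calls |}.

(* One inner iteration, including the end of the stage when it exits the
   inner loop. The two nested loops amount to iterating this function. *)
Definition rlm_step (R : realType) (n : nat) (X : set 'rV[R]_n)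
    (f : 'rV[R]_n -> R) (g : 'rV[R]_n -> 'rV[R]_n) (beta : R) (B : nat)
    (s : rlm_state R n) : rlm_state R n :=
  let o := one_step X f g (st_rho s) beta B
             (st_z s) (st_psi s) (st_counter s) (st_best s) in
  let calls := (st_calls s).+1 in
  if step_best o < st_low s then
    next_stage f (st_xbar s) (st_psibar s) (st_gapbar s)
      (step_best o) (st_rho s) calls
  else if step_gap o <= st_gapbar s / 2 then
    next_stage f (st_z s)
      (fun x => Num.max (step_cut o x)
         (Num.max (linearization f g (st_z s) x)
                  (linearization f g (trial_point o) x)))
      (step_gap o) (step_best o) (st_rho s) calls
  else
    {| st_xbar := st_xbar s; st_psibar := st_psibar s;
       st_gapbar := st_gapbar s; st_best := step_best o;
       st_low := st_low s; st_rho := st_rho s;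
       st_z := next_center o; st_psi := next_model o;
       st_counter := next_counter o; st_calls := calls |}.

(* The state after T inner iterations, counted over all stages. *)
Definition rlm_pbm (R : realType) (n : nat) (X : set 'rV[R]_n)
    (f : 'rV[R]_n -> R) (g : 'rV[R]_n -> 'rV[R]_n) (x0 : 'rV[R]_n)
    (rho1 beta : R) (B T : nat) : rlm_state R n :=
  iter T (rlm_step X f g beta B) (rlm_init X f g x0 rho1).

(* Main.v *)
Require Import Defs.
From HB Require Import structures.
From mathcomp Require Import all_boot all_order all_algebra.
From mathcomp Require Import all_classical all_reals all_analysis.
From mathcomp Require Import ring lra.

(** Measure a model psi at a center z by the smallest D such that
    f z - D <= psi + rho / 2 |. - z|^2 on X; this is the certificate value
    Delta_rho(z; psi), and [certified] is the inequality itself.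

    Why a certificate controls the error.  Testing the inequality on the segment
    from z to a minimizer and using quadratic growth gives
    mu (f z - min f) <= 4 rho D as soon as rho >= mu / 2
    ([certified_error_bound]).  Dividing rho by c and multiplying D by c keeps a
    certificate valid ([certified_scale]).  So the doubling loop stops at the
    latest when rho reaches mu: rho never falls to mu / 2, and it is halved
    at most about log2 (rho1 / mu) times.  The product rho * gapbar is unchanged
    by a doubling, is at least halved whenever a stage ends by the gap test, and
    is at most |g x0|^2 / 2 initially; by the error bound, at most about
    log2 (|g x0|^2 / (mu eps)) stages end that way before accuracy eps.

    Why a stage is short.  While the stage runs, f at the center stays within
    4 gapbar of its initial value and each serious step decreases it by
    beta gapbar / 2, so there are at most 8 / beta serious steps
    ([serious_count]).  Between two of them the model's proximal value never
    decreases.  Consider B + 1 consecutive null steps without a reset: by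
    pigeonhole two of the trial points, u before y, lie in the same piece.  The
    cut at u is still in the model when y is computed, so the null test bounds
    (1 - beta) gap by L / 2 |y - u|^2; strong convexity of the proximal
    objective shows that the gap has dropped by at least rho / 2 |y - u|^2
    since u.  Hence each such block divides the gap at least by
    1 + (1 - beta) rho / L ([null_step_same_piece]).  The gap right after a
    serious step is O(gapbar / beta), and the stage ends once it is
    gapbar / 2, so O(1 + L / rho) blocks suffice by Bernoulli's inequality.

    A stage with coefficient rho thus costs O(B (1 + L / rho)) oracle calls.
    Stages ending by the gap test are charged at rho = mu / 2.  The other ones
    at least halve rho, so their L / rho form a geometric series of sum
    O(L / mu), which is why log (rho1 / mu) is multiplied by B only.

    All counters are carried by an invariant of [rlm_step]
    ([rlm_step_invariant]), so the two nested loops are never separated. *)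

Set Implicit Arguments.
Unset Strict Implicit.
Unset Printing Implicit Defensive.

Import Order.TTheory GRing.Theory Num.Theory.
Import numFieldNormedType.Exports.

Local Open Scope classical_set_scope.
Local Open Scope ring_scope.

(** * Euclidean geometry of row vectors *)

Section Euclidean.
Variables (R : realType) (n : nat).
Implicit Types (u v w x y z : 'rV[R]_n) (a : R).

Lemma dotC u v : dot u v = dot v u.
Proof. by apply: eq_bigr => i _; rewrite mulrC. Qed.

Lemma dotDl u v w : dot (u + v) w = dot u w + dot v w.
Proof. by rewrite -big_split; apply: eq_bigr => i _; rewrite mxE mulrDl. Qed.

Lemma dotDr u v w : dot w (u + v) = dot w u + dot w v.
Proof. by rewrite dotC dotDl !(dotC w). Qed.

Lemma dotZl a u v : dot (a *: u) v = a * dot u v.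
Proof. by rewrite mulr_sumr; apply: eq_bigr => i _; rewrite mxE mulrA. Qed.

Lemma dotZr a u v : dot u (a *: v) = a * dot u v.
Proof. by rewrite dotC dotZl dotC. Qed.

Lemma dotNl u v : dot (- u) v = - dot u v.
Proof. by rewrite -scaleN1r dotZl mulN1r. Qed.

Lemma dotNr u v : dot v (- u) = - dot v u.
Proof. by rewrite dotC dotNl dotC. Qed.

Lemma dotvv_ge0 u : 0 <= dot u u.
Proof. by apply: sumr_ge0 => i _; rewrite -expr2 sqr_ge0. Qed.

Lemma enorm_sq u : enorm u ^+ 2 = dot u u.
Proof. by rewrite sqr_sqrtr // dotvv_ge0. Qed.

Lemma enorm_ge0 u : 0 <= enorm u.
Proof. exact: sqrtr_ge0. Qed.

Definition dotE := (dotDl, dotDr, dotNl, dotNr, dotZl, dotZr).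

Lemma enorm_sqZ a u : enorm (a *: u) ^+ 2 = a ^+ 2 * enorm u ^+ 2.
Proof. by rewrite !enorm_sq dotZl dotZr mulrA expr2. Qed.

Lemma enorm_sqBC u v : enorm (u - v) ^+ 2 = enorm (v - u) ^+ 2.
Proof. by rewrite !enorm_sq -opprB dotNl dotNr opprK. Qed.

Lemma coord_sq_le u i : u 0 i ^+ 2 <= dot u u.
Proof.
rewrite /dot (bigD1 i) //= -expr2 lerDl.
by apply: sumr_ge0 => j _; rewrite -expr2 sqr_ge0.
Qed.

(** Expand |u + s v|^2 >= 0. *)
Lemma young u v (s : R) : 0 < s ->
  - dot u v <= dot u u / (2 * s) + s / 2 * dot v v.
Proof.
move=> s0; have := dotvv_ge0 (u + s *: v); rewrite !dotE (dotC v u) => h.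
have sn : s != 0 by rewrite gt_eqF.
have -> : dot u u / (2 * s) + s / 2 * dot v v =
  (dot u u + s * dot u v + s * (dot u v + s * dot v v)) / (2 * s) - dot u v.
  by field.
have : 0 <= (dot u u + s * dot u v + s * (dot u v + s * dot v v)) / (2 * s).
  by apply: divr_ge0 => //; lra.
lra.
Qed.

Lemma continuous_dotl u : continuous (dot u).
Proof.
have h i : predT i -> continuous (fun v : 'rV[R]_n => u 0 i * v 0 i : R^o).
  move=> _ v; apply: (@continuousM R _ (fun=> u 0 i) (fun v => v 0 i)).
    exact: cst_continuous.
  exact: coord_continuous.
by have := continuous_big (@add_continuous R^o)
  (r := index_enum 'I_n) (x0 := 0) h.
Qed.

Lemma continuous_dotvv : continuous (fun v : 'rV[R]_n => dot v v).
Proof.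
have h i : predT i -> continuous (fun v : 'rV[R]_n => v 0 i * v 0 i : R^o).
  by move=> _ v; apply: (@continuousM R _ (fun v => v 0 i) (fun v => v 0 i));
    exact: coord_continuous.
by have := continuous_big (@add_continuous R^o)
  (r := index_enum 'I_n) (x0 := 0) h.
Qed.

Lemma continuous_enorm_sq z :
  continuous (fun x : 'rV[R]_n => enorm (x - z) ^+ 2).
Proof.
move=> x.
rewrite (_ : (fun x => _) = fun x => dot x x + - dot (2 *: z) x + dot z z).
  have c1 := @continuous_dotvv x; have c2 := @continuous_dotl (2 *: z) x.
  have c3 := @cst_continuous 'rV[R]_n R^o (dot z z) x.
  exact: (@cvgD R R^o _ _ _ _ _ _ _ (@cvgB R R^o _ _ _ _ _ _ _ c1 c2) c3).
by apply/funext => w; rewrite enorm_sq !dotE (dotC z w); ring.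
Qed.

Lemma convex_set_segment (X : set 'rV[R]_n) x y (t : R) : convex_set X ->
  X x -> X y -> 0 <= t <= 1 -> X (x + t *: (y - x)).
Proof.
move=> cX Xx Xy /andP[t0 t1].
have t01 : Itv.spec (@Itv.num_sem R) (Itv.Real `[0%Z, 1%Z]) t.
  by apply/and3P; split; rewrite ?num_real //= bnd_simp.
have := cX y x (Itv.mk t01); rewrite !inE => /(_ Xy Xx).
congr X; rewrite /conv /= /isConvexSpace.conv /=.
by rewrite /unstable.onem scalerBl scale1r scalerBr addrCA.
Qed.

End Euclidean.

(** * Models and their proximal points *)

Section Models.
Variables (R : realType) (n : nat).
Implicit Types (u v w x y z : 'rV[R]_n) (t rho : R) (X : set 'rV[R]_n).
Implicit Types (psi phi : 'rV[R]_n -> R).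

(** What the proximal subproblem needs from a maximum of finitely many affine
    functions: the affine minorant gives coercivity. *)
Definition model psi : Prop :=
  [/\ continuous psi,
      forall x y t, 0 <= t <= 1 ->
        psi (x + t *: (y - x)) <= psi x + t * (psi y - psi x) &
      exists c v, forall x, c + dot v x <= psi x].

Lemma model_affine c v u : model (fun x => c + dot v (x - u)).
Proof.
split; last by exists (c - dot v u), v => x; rewrite dotDr dotNr; lra.
- move=> x; rewrite (_ : (fun x => _) = fun x => (c - dot v u) + dot v x).
    have c1 := @continuous_dotl _ _ v x.
    have c2 := @cst_continuous 'rV[R]_n R^o (c - dot v u) x.
    exact: (@cvgD R R^o _ _ _ _ _ _ _ c2 c1).
  by apply/funext => w; rewrite dotDr dotNr; lra.
- move=> x y t _; rewrite !dotE; lra.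
Qed.

Lemma model_max psi phi : model psi -> model phi ->
  model (fun x => Num.max (psi x) (phi x)).
Proof.
move=> [cpsi kpsi [c [v lpsi]]] [cphi kphi _]; split.
- by move=> x; apply: (@continuous_max R _ psi phi x (cpsi x) (cphi x)).
- move=> x y t t01; rewrite ge_max; case/andP: (t01) => t0 t1.
  have := kpsi x y t t01; have := kphi x y t t01.
  have [] : psi x <= Num.max (psi x) (phi x) /\
      phi x <= Num.max (psi x) (phi x).
    by rewrite !le_max !lexx orbT.
  have [] : psi y <= Num.max (psi y) (phi y) /\
      phi y <= Num.max (psi y) (phi y).
    by rewrite !le_max !lexx orbT.
  move: (Num.max _ _) (Num.max _ _) => a b.
  by move=> *; apply/andP; split; nra.
- by exists c, v => x; rewrite le_max lpsi.
Qed.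

Lemma prox_exists X rho psi z : closed X -> X z -> 0 < rho -> model psi ->
  argmin_on X (fun x => psi x + rho / 2 * enorm (x - z) ^+ 2) !=set0.
Proof.
move=> clX Xz rho0 [cpsi _ [c [v lpsi]]].
set h := fun x => _.
have ch : continuous h.
  rewrite /h => x; have c1 := @continuous_enorm_sq _ _ z x.
  have c2 := @cst_continuous 'rV[R]_n R^o (rho / 2) x.
  have c3 := @cvgM R _ _ (nbhs_filter x) _ _ _ _ c2 c1.
  exact: (@cvgD R R^o _ _ _ _ _ _ _ (cpsi x) c3).
(* Coercivity: Young's inequality absorbs the affine minorant into half of
   the proximal term, so that h exceeds h z outside a ball around z. *)
pose m := c + dot v z - dot v v / rho.
have hlow x : m + rho / 4 * dot (x - z) (x - z) <= h x.
  have s0 : 0 < rho / 2 by lra.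
  have := young v (x - z) s0; have := lpsi x.
  have -> : dot v x = dot v z + dot v (x - z) by rewrite dotDr dotNr; ring.
  rewrite /h enorm_sq /m.
  have -> : 2 * (rho / 2) = rho by field.
  lra.
pose r := (h z - m) * 4 / rho + 1.
have hbig x i : r < (x - z) 0 i ^+ 2 -> h z < h x.
  move=> ri; apply: lt_le_trans (hlow x).
  have := coord_sq_le (x - z) i => le_i.
  have : (h z - m) * 4 / rho < dot (x - z) (x - z) by rewrite /r in ri; lra.
  by rewrite ltr_pdivrMr //; lra.
have r1 : 1 <= r.
  have := hlow z; rewrite subrr /dot big1 => [|i _]; last by rewrite mxE mul0r.
  rewrite mulr0 addr0 => hz; rewrite /r lerDr.
  by apply: divr_ge0; lra.
pose box := [set x : 'rV[R]_n | forall i,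
  `[z 0 i - r, z 0 i + r]%classic (x ord0 i)].
have cbox : compact box.
  by apply: (@rV_compact _ _ (fun i => `[z 0 i - r, z 0 i + r]%classic)) => i;
    exact: segment_compact.
have A0 : (box `&` X) !=set0.
  exists z; split=> // i /=; rewrite in_itv /=; apply/andP; split; lra.
have [y] := compact_EVT_min A0 (compact_closedI cbox clX)
  (continuous_subspaceT ch).
rewrite inE => -[_ Xy] ymin; exists y; split=> // x Xx.
have [bx|nbx] := pselect (box x).
  by apply: ymin; rewrite inE.
have hz : h y <= h z.
  apply: ymin; rewrite inE; split=> // i /=.
  by rewrite in_itv /=; apply/andP; split; lra.
apply: (le_trans hz); apply: ltW.
have /existsNP[i] := nbx; rewrite /= in_itv /= => /negP ni.
apply: (@hbig x i); rewrite !mxE.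
case/nandP: ni; rewrite -ltNge => ?; nra.
Qed.

Lemma prox_pointP X rho psi z : closed X -> X z -> 0 < rho -> model psi ->
  argmin_on X (fun x => psi x + rho / 2 * enorm (x - z) ^+ 2)
    (prox_point X rho psi z).
Proof.
by move=> clX Xz rho0 mpsi; apply: xgetPex; exact: prox_exists.
Qed.

(** The proximal objective of the cut at y is minimized at y, with curvature
    rho in every direction. *)
Lemma prox_cut_identity rho a y z x :
  a + rho * dot (z - y) (x - y) + rho / 2 * enorm (x - z) ^+ 2 =
  a + rho / 2 * enorm (z - y) ^+ 2 + rho / 2 * enorm (x - y) ^+ 2.
Proof.
by rewrite !enorm_sq !dotE (dotC y z) (dotC x z) (dotC x y); field.
Qed.

(** First-order optimality of y: moving from y a fraction t towards x raises the
   linear part of the proximal objective up to O(t^2), and t tends to 0. *)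
Lemma prox_cut_le X rho psi y z x : convex_set X -> 0 < rho -> model psi ->
  argmin_on X (fun x => psi x + rho / 2 * enorm (x - z) ^+ 2) y -> X x ->
  psi y + rho * dot (z - y) (x - y) <= psi x.
Proof.
move=> cX rho0 [_ kpsi _] [Xy ymin] Xx.
set d := psi x - (psi y + rho * dot (z - y) (x - y)).
suff : 0 <= d by rewrite /d; lra.
have key t : 0 < t <= 1 -> 0 <= d + t * (rho / 2 * enorm (x - y) ^+ 2).
  move=> /andP[t0 t1].
  have t01 : 0 <= t <= 1 by rewrite ltW.
  have := ymin _ (convex_set_segment cX Xy Xx t01).
  have := kpsi y x t t01.
  have := prox_cut_identity rho (psi y) y z (y + t *: (x - y)).
  have -> : y + t *: (x - y) - y = t *: (x - y) by rewrite addrC addKr.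
  rewrite dotZr enorm_sqZ (enorm_sqBC z y) => e1 e2 /= e3.
  have : 0 <= t * (d + t * (rho / 2 * enorm (x - y) ^+ 2)) by rewrite /d; lra.
  by rewrite pmulr_rge0.
rewrite leNgt; apply/negP => dneg.
set e := rho / 2 * enorm (x - y) ^+ 2 in key.
have e0 : 0 <= e by apply: mulr_ge0; [lra|exact: sqr_ge0].
have [le_e|lt_e] := leP e (- d / 2).
  have /key : 0 < (1 : R) <= 1 by rewrite ltr01 lexx.
  lra.
have ep : 0 < e by lra.
have /key : 0 < - d / 2 / e <= 1.
  rewrite divr_gt0 ?ler_pdivrMr //; lra.
rewrite mulfVK ?gt_eqF //; lra.
Qed.

End Models.

(** * Certificates and quadratic growth *)

Section Certificates.
Variables (R : realType) (n : nat) (X : set 'rV[R]_n) (f : 'rV[R]_n -> R).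
Implicit Types (u v w x y z : 'rV[R]_n) (t rho D : R) (psi : 'rV[R]_n -> R).

Definition minorant psi := forall x, X x -> psi x <= f x.

(** The bound Delta_rho(z; psi) <= D, stated pointwise. *)
Definition certified rho z psi D :=
  forall x, X x -> f z - D <= psi x + rho / 2 * enorm (x - z) ^+ 2.

Lemma certified_ge0 rho z psi D : X z -> minorant psi ->
  certified rho z psi D -> 0 <= D.
Proof.
move=> Xz /(_ z Xz) le_f /(_ z Xz).
by rewrite subrr enorm_sq -(scale0r 0) dotZl mul0r mulr0 addr0; lra.
Qed.

Lemma certified_le rho rho' z psi psi' D D' : rho <= rho' -> D <= D' ->
  (forall x, X x -> psi x <= psi' x) ->
  certified rho z psi D -> certified rho' z psi' D'.
Proof.
move=> le_rho le_D le_psi cert x Xx; have := cert x Xx; have := le_psi x Xx.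
have : rho / 2 * enorm (x - z) ^+ 2 <= rho' / 2 * enorm (x - z) ^+ 2.
  by rewrite ler_wpM2r ?sqr_ge0 // ler_wpM2r // invr_ge0.
lra.
Qed.

(** By convexity of psi, the bound at x for the smaller coefficient follows from
    c times the bound at z + (x - z) / c for the larger one. *)
Lemma certified_scale rho z psi D (c : R) : convex_set X -> X z -> model psi ->
  minorant psi -> 1 <= c -> certified rho z psi D ->
  certified (rho / c) z psi (c * D).
Proof.
move=> cX Xz [_ kpsi _] le_f c1 cert x Xx.
have c0 : 0 < c by lra.
have s01 : 0 <= c^-1 <= 1 by rewrite invr_ge0 (ltW c0) invf_le1.
have := cert _ (convex_set_segment cX Xz Xx s01).
rewrite [in enorm _]addrC addKr enorm_sqZ.
have := kpsi z x _ s01; have := le_f z Xz.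
move: (psi (z + _)) (enorm _ ^+ 2) => p N le_fz le_p le_D.
have cn : c != 0 by rewrite gt_eqF.
have : c * (f z - D) <=
    c * (psi z + c^-1 * (psi x - psi z) + rho / 2 * (c^-1 ^+ 2 * N)).
  by rewrite ler_wpM2l ?(ltW c0) //; lra.
have -> : c * (psi z + c^-1 * (psi x - psi z) + rho / 2 * (c^-1 ^+ 2 * N)) =
  (c - 1) * psi z + psi x + rho / c / 2 * N by field.
have : (c - 1) * psi z <= (c - 1) * f z by rewrite ler_wpM2l //; lra.
lra.
Qed.

Lemma min_value_argmin x : argmin_on X f x -> min_value X f = f x.
Proof.
move=> [Xx xmin]; apply/eqP; rewrite eq_le; apply/andP; split.
  by apply: ge_inf; [exists (f x) => _ [y Xy <-]; exact: xmin|exists x].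
by apply: lb_le_inf; [exists (f x), x|move=> _ [y Xy <-]; exact: xmin].
Qed.

Lemma min_value_le x : argmin_on X f !=set0 -> X x -> min_value X f <= f x.
Proof.
by move=> [a amin] Xx; rewrite (min_value_argmin amin); apply: amin.2.
Qed.

Variables (g : 'rV[R]_n -> 'rV[R]_n) (mu : R).
Hypothesis g_sub : forall u, X u -> subdifferential X f u (g u).
Hypothesis argmin0 : argmin_on X f !=set0.
Hypothesis mu_gt0 : 0 < mu.
Hypothesis growth_mu : growth_modulus X f = mu%:E.

(** The supremum in the growth modulus is attained, since each admissible
   inequality is closed in nu. *)
Lemma quadratic_growth x : X x ->
  mu / 2 * edist_to x (argmin_on X f) ^+ 2 <= f x - min_value X f.
Proof.
move=> Xx; set d := edist_to _ _ ^+ 2.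
have d0 : 0 <= d by exact: sqr_ge0.
apply/ler_addgt0Pr => e e0.
have lt_mu : ((mu - e / (d + 1))%:E < growth_modulus X f)%E.
  by rewrite growth_mu lte_fin ltrBlDr ltrDl divr_gt0 //; lra.
have [_ [nu [nu0 /(_ x Xx) grow] <-]] := ereal_sup_gt lt_mu.
rewrite lte_fin -/d in grow * => lt_nu.
have : e / (d + 1) * d <= e.
  by rewrite mulrAC ler_pdivrMr; [nra|lra].
have : (mu - e / (d + 1)) * d <= nu * d by rewrite ler_wpM2r // ltW.
move: (e / (d + 1)) => q; lra.
Qed.

(** The distance to the argmin is an infimum; a common lower bound K of all
    |x - a|^2 stands in for it, so that no nearest minimizer is needed. *)
Lemma quadratic_growth_lb x (K : R) : X x ->
  (forall a, argmin_on X f a -> K <= enorm (x - a) ^+ 2) ->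
  mu * K <= 2 * (f x - min_value X f).
Proof.
move=> Xx leK; have := min_value_le argmin0 Xx => ge0.
have [K0|K0] := leP K 0.
  by have := mulr_ge0_le0 (ltW mu_gt0) K0; lra.
have : Num.sqrt K <= edist_to x (argmin_on X f).
  apply: lb_le_inf; first by have [a ?] := argmin0; exists (enorm (x - a)), a.
  move=> _ [a /leK Ka <-].
  by rewrite -(ger0_norm (enorm_ge0 (x - a))) -sqrtr_sqr ler_wsqrtr.
rewrite -(@ler_pXn2r _ 2) ?nnegrE ?sqrtr_ge0 //; last first.
  by apply: lb_le_inf; [have [a ?] := argmin0; exists (enorm (x - a)), a
    |move=> _ [a _ <-]; exact: enorm_ge0].
rewrite sqr_sqrtr ?(ltW K0) // => leKd.
have := quadratic_growth Xx; move: (edist_to _ _ ^+ 2) leKd => N leKN.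
have : mu * K <= mu * N by rewrite ler_wpM2l // ltW.
lra.
Qed.

(** Average the two subgradient inequalities at the intermediate point. *)
Lemma segment_le z a t : convex_set X -> X z -> X a -> 0 <= t <= 1 ->
  f (z + t *: (a - z)) <= f z + t * (f a - f z).
Proof.
move=> cX Xz Xa t01; case/andP: (t01) => t0 t1.
have Xp := convex_set_segment cX Xz Xa t01.
set p := z + _ in Xp *.
have := g_sub Xp Xz; have := g_sub Xp Xa.
have -> : a - p = (1 - t) *: (a - z).
  by rewrite /p scalerBl scale1r opprD addrA.
have -> : z - p = (- t) *: (a - z) by rewrite /p opprD addNKr scaleNr.
rewrite !dotZr; move: (dot _ _) => q ha hz.
have : t * (f p + (1 - t) * q) <= t * f a by rewrite ler_wpM2l.
have : (1 - t) * (f p + - t * q) <= (1 - t) * f z by rewrite ler_wpM2l //; lra.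
lra.
Qed.

(** Test the certificate at z + lam (a - z) for minimizers a: this gives
   lam delta - D <= rho lam^2 / 2 |z - a|^2 with delta = f z - min f.  Quadratic
   growth bounds the best |z - a|^2 by 2 delta / mu, and lam = mu / (2 rho)
   makes the right-hand side half of lam delta. *)
Lemma certified_error_bound rho z psi D : convex_set X -> X z -> minorant psi ->
  mu / 2 <= rho -> certified rho z psi D ->
  mu * (f z - min_value X f) <= 4 * rho * D.
Proof.
move=> cX Xz le_f le_rho cert.
have mu0 := mu_gt0; have rho0 : 0 < rho by lra.
set de := f z - min_value X f.
pose lam := mu / (2 * rho).
have lam0 : 0 < lam by apply: divr_gt0 => //; lra.
have lam01 : 0 <= lam <= 1 by rewrite (ltW lam0) ler_pdivrMr; lra.
pose K := (lam * de - D) * 2 / (rho * lam ^+ 2).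
have rn : rho != 0 by rewrite gt_eqF.
have mn : mu != 0 by rewrite gt_eqF.
have pos : 0 < rho * lam ^+ 2 by rewrite mulr_gt0 // exprn_gt0.
have leK a : argmin_on X f a -> K <= enorm (z - a) ^+ 2.
  move=> amin; have := amin.1 => Xa.
  rewrite /K ler_pdivrMr // enorm_sqBC.
  have Xp := convex_set_segment cX Xz Xa lam01.
  have := cert _ Xp; have := le_f _ Xp; have := segment_le cX Xz Xa lam01.
  rewrite -(min_value_argmin amin) [in enorm _]addrC addKr enorm_sqZ.
  rewrite /de; move: (enorm _ ^+ 2) => N; lra.
have := quadratic_growth_lb Xz leK.
have -> : mu * K = 4 * de - 8 * rho * D / mu.
  by rewrite /K /lam; field; rewrite mn rn.
rewrite -/de => h; have : 2 * de <= 8 * rho * D / mu by lra.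
rewrite ler_pdivlMr //; lra.
Qed.

End Certificates.

(** * One step of the method *)

Section Steps.
Variables (R : realType) (n : nat) (X : set 'rV[R]_n) (f : 'rV[R]_n -> R).
Variables (g : 'rV[R]_n -> 'rV[R]_n).
Implicit Types (u v w x y z : 'rV[R]_n) (t rho D : R) (psi phi : 'rV[R]_n -> R).

Definition cutting_plane psi rho z y x : R := psi y + rho * dot (z - y) (x - y).

Lemma model_cutting_plane psi rho z y : model (cutting_plane psi rho z y).
Proof.
have := model_affine (psi y) (rho *: (z - y)) y; congr model.
by apply/funext => x; rewrite dotZl.
Qed.

Lemma model_linearization u : model (linearization f g u).
Proof. exact: model_affine. Qed.

Lemma minorant_max psi phi : minorant X f psi -> minorant X f phi ->
  minorant X f (fun x => Num.max (psi x) (phi x)).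
Proof. by move=> h1 h2 x Xx; rewrite ge_max h1 // h2. Qed.

Section OneStep.
Variables (rho : R) (z : 'rV[R]_n) (psi : 'rV[R]_n -> R).
Hypotheses (clX : closed X) (cX : convex_set X) (Xz : X z) (rho_gt0 : 0 < rho).
Hypotheses (mpsi : model psi) (le_psi : minorant X f psi).

Let y := prox_point X rho psi z.
Let gap := f z - psi y - rho / 2 * enorm (z - y) ^+ 2.
Let cut := cutting_plane psi rho z y.

Let y_min := prox_pointP clX Xz rho_gt0 mpsi.

Lemma prox_in : X y. Proof. exact: y_min.1. Qed.

Lemma cut_le x : X x -> cut x <= psi x.
Proof. exact: prox_cut_le. Qed.

Lemma cut_prox x :
  cut x + rho / 2 * enorm (x - z) ^+ 2 =
  f z - gap + rho / 2 * enorm (x - y) ^+ 2.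
Proof. by rewrite prox_cut_identity /gap; ring. Qed.

Lemma psi_prox : psi y + rho / 2 * enorm (y - z) ^+ 2 = f z - gap.
Proof. by rewrite /gap (enorm_sqBC y); ring. Qed.

Lemma psi_prox_growth x : X x ->
  f z - gap + rho / 2 * enorm (x - y) ^+ 2 <=
  psi x + rho / 2 * enorm (x - z) ^+ 2.
Proof. by move=> Xx; rewrite -cut_prox lerD2r cut_le. Qed.

Lemma certified_cut phi : (forall x, X x -> cut x <= phi x) ->
  certified X f rho z phi gap.
Proof.
move=> le_phi x Xx; have := le_phi x Xx; have := cut_prox x.
have : 0 <= rho / 2 * enorm (x - y) ^+ 2.
  by rewrite mulr_ge0 ?sqr_ge0 // divr_ge0 // ltW.
lra.
Qed.

Lemma certified_gap_le D : certified X f rho z psi D -> gap <= D.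
Proof. by move=> /(_ y prox_in); rewrite psi_prox; lra. Qed.

Lemma certified_mono phi D : (forall x, X x -> psi x <= phi x) ->
  certified X f rho z psi D -> certified X f rho z phi D.
Proof. by move=> h; apply: certified_le. Qed.

(** The affine cut lies below f at the center itself. *)
Lemma prox_dist_le : rho * enorm (z - y) ^+ 2 <= f z - psi y.
Proof.
have := cut_le Xz; have := le_psi Xz.
by rewrite /cut /cutting_plane -enorm_sq; lra.
Qed.

Lemma gap_le_decrease : gap <= f z - psi y.
Proof.
have : 0 <= rho * enorm (z - y) ^+ 2 by rewrite mulr_ge0 ?sqr_ge0 // ltW.
by rewrite /gap; lra.
Qed.

(** Moving the center to y shifts the minimizer of the cut's proximal
   objective by z - y, which costs another rho / 2 |z - y|^2. *)
Lemma certified_serious phi : f y <= f z -> (forall x, X x -> cut x <= phi x) ->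
  certified X f rho y phi (3 / 2 * (f z - psi y)).
Proof.
move=> le_fy le_phi x Xx; have := le_phi x Xx.
have := dotvv_ge0 ((z - y) + (x - y)).
rewrite dotDl !(dotDr (z - y)) (dotC (x - y)) -!enorm_sq => h.
have : 0 <= rho / 2 * (enorm (z - y) ^+ 2 + dot (z - y) (x - y) +
  (dot (z - y) (x - y) + enorm (x - y) ^+ 2)).
  by rewrite mulr_ge0 // ?divr_ge0 // ltW.
rewrite /cut /cutting_plane; have := prox_dist_le.
lra.
Qed.

Variables (k : nat) (L : R) (P : 'I_k -> set 'rV[R]_n) (beta : R).
Hypotheses (cover : \bigcup_i P i = X) (L_gt0 : 0 < L) (beta01 : 0 < beta < 1).
Hypothesis oracle : piecewise_oracle_bound L P f g.
Hypothesis g_sub : forall u, X u -> subdifferential X f u (g u).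

Lemma minorant_linearization u : X u -> minorant X f (linearization f g u).
Proof. by move=> Xu x Xx; exact: g_sub. Qed.

Definition null_rate : R := (1 - beta) * rho / L.

Lemma null_rate_gt0 : 0 < null_rate.
Proof. by rewrite divr_gt0 // mulr_gt0 // subr_gt0; case/andP: beta01. Qed.

(** A trial point u of the current block in piece i, as the model remembers it:
    its linearization lies below phi, and the proximal objective of phi exceeds
    the value f z - D, a lower bound of the proximal value reached at u, by
    the strong-convexity term centered at u. *)
Definition bundled phi D (i : 'I_k) : Prop := exists u,
  [/\ P i u, forall x, X x -> linearization f g u x <= phi x &
      forall x, X x ->
        f z - D + rho / 2 * enorm (x - u) ^+ 2 <=
        phi x + rho / 2 * enorm (x - z) ^+ 2].

(** The situation after b null steps of a block whose initial gap was at most D: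
    either the gap has already contracted, or the b trial points lie in
    distinct pieces, the set S. *)
Definition block phi D b : Prop :=
  certified X f rho z phi D /\
  (certified X f rho z phi (D / (1 + null_rate)) \/
   exists S : {set 'I_k}, #|S| = b /\ forall i, i \in S -> bundled phi D i).

Lemma bundled_mono phi psi' D i : (forall x, X x -> phi x <= psi' x) ->
  bundled phi D i -> bundled psi' D i.
Proof.
move=> le_phi [u [Pu lin grow]]; exists u; split=> // x Xx.
  exact: le_trans (lin x Xx) (le_phi x Xx).
by have := grow x Xx; have := le_phi x Xx; lra.
Qed.

(** With N = |y - u|^2, the oracle bound gives
    (1 - beta) gap <= f y - psi y <= L / 2 N, and the growth of the proximal
    objective away from u gives gap + rho / 2 N <= D. *)
Lemma null_step_same_piece D i : beta * (f z - psi y) > f z - f y ->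
  bundled psi D i -> P i y -> gap <= D / (1 + null_rate).
Proof.
move=> null [u [Pu lin grow]] Py.
have c0 := null_rate_gt0; have L0 := L_gt0; have /andP[b0 b1] := beta01.
have := oracle Py Pu; have := lin y prox_in; have := grow y prox_in.
rewrite psi_prox; set N := enorm _ ^+ 2 => h1 h2 h3.
rewrite ler_pdivlMr ?addr_gt0 // mulrDr mulr1.
suff : gap * null_rate <= rho / 2 * N by lra.
have h4 : (1 - beta) * gap <= L / 2 * N.
  have : (1 - beta) * gap <= (1 - beta) * (f z - psi y).
    by apply: ler_wpM2l; [lra|exact: gap_le_decrease].
  lra.
have -> : gap * null_rate = rho / L * ((1 - beta) * gap).
  by rewrite /null_rate; ring.
have -> : rho / 2 * N = rho / L * (L / 2 * N) by field; rewrite gt_eqF.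
by apply: ler_wpM2l h4; rewrite divr_ge0 // ltW.
Qed.

Lemma null_step D b phi : beta * (f z - psi y) > f z - f y -> block psi D b ->
  (forall x, X x -> psi x <= phi x) ->
  (forall x, X x -> linearization f g y x <= phi x) ->
  gap <= D / (1 + null_rate) \/
  exists S : {set 'I_k}, #|S| = b.+1 /\ forall i, i \in S -> bundled phi D i.
Proof.
move=> null [certD [contr|[S [cardS bunS]]]] le_phi lin_phi.
  by left; exact: certified_gap_le.
have [i _ Py] : (\bigcup_i P i) y by rewrite cover; exact: prox_in.
have [iS|iS] := boolP (i \in S).
  by left; apply: null_step_same_piece (bunS i iS) Py.
right; exists (i |: S); split; first by rewrite cardsU1 iS cardS.
move=> i'; rewrite !inE => /orP[/eqP->|/bunS]; last exact: bundled_mono.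
exists y; split=> // x Xx; have := psi_prox_growth Xx; have := le_phi x Xx.
by have := certified_gap_le certD; lra.
Qed.

Lemma null_step_block D b phi : beta * (f z - psi y) > f z - f y ->
  block psi D b ->
  (forall x, X x -> psi x <= phi x) ->
  (forall x, X x -> linearization f g y x <= phi x) ->
  block phi D b.+1.
Proof.
move=> null blk le_phi lin_phi; split; first exact: certified_mono blk.1.
have [contr|?] := null_step null blk le_phi lin_phi; last by right.
left; apply: (certified_le (lexx rho) contr (fun x _ => lexx (phi x))).
apply: certified_cut => x Xx; exact: le_trans (cut_le Xx) (le_phi x Xx).
Qed.

(** A block with more trial points than pieces has two of them in one piece. *)
Lemma null_step_contract D b : beta * (f z - psi y) > f z - f y ->
  block psi D b -> (k <= b)%N -> gap <= D / (1 + null_rate).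
Proof.
move=> null blk kb.
pose phi x := Num.max (psi x) (linearization f g y x).
have [||//|[S [cardS _]]] := @null_step D b phi null blk.
- by move=> x _; rewrite le_max lexx.
- by move=> x _; rewrite le_max lexx orbT.
have := max_card S; rewrite cardS card_ord => lt.
by have := leq_trans lt kb; rewrite ltnn.
Qed.

Lemma block_start phi D : certified X f rho z phi D -> block phi D 0.
Proof.
move=> cert; split=> //; right; exists finset.set0.
rewrite cards0; split=> // i.
by rewrite inE.
Qed.

End OneStep.
End Steps.

(** * Budgets *)

Section Complexity.
Variables (R : realType) (n : nat) (X : set 'rV[R]_n) (f : 'rV[R]_n -> R).
Variables (g : 'rV[R]_n -> 'rV[R]_n) (k : nat) (L : R).
Variables (P : 'I_k -> set 'rV[R]_n).
Variables (mu : R) (x0 : 'rV[R]_n) (B : nat) (rho1 beta : R).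
Hypotheses (beta01 : 0 < beta < 1) (clX : closed X) (cX : convex_set X).
Hypotheses (argmin0 : argmin_on X f !=set0).
Hypothesis g_sub : forall u, X u -> subdifferential X f u (g u).
Hypotheses (k_gt0 : (0 < k)%N) (L_gt0 : 0 < L) (cover : \bigcup_i P i = X).
Hypothesis oracle : piecewise_oracle_bound L P f g.
Hypotheses (growth_mu : growth_modulus X f = mu%:E) (mu_gt0 : 0 < mu).
Hypotheses (Xx0 : X x0) (k_le_B : (k <= B)%N) (le_rho1 : mu <= rho1).
Implicit Types (x y z : 'rV[R]_n) (rho D gap best : R) (psi : 'rV[R]_n -> R).
Implicit Types (s : rlm_state R n) (h j sg q : nat).

Let fmin := min_value X f.

(** Iterations at one center: at most 12 / (beta c) + 2 blocks of B + 1 steps,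
    where c is the null rate.  The gap starts below 6 / beta gapbar and exceeds
    gapbar / 2 during the stage, so by Bernoulli's inequality at most
    12 / (beta c) contractions precede the last one; the 2 stands for the last
    completed block and the block in progress. *)
Definition center_budget rho : R :=
  (12 / beta / null_rate rho L beta + 2) * B.+1%:R.

(** Chosen so that 8 / beta + 1 center budgets fit in one stage budget. *)
Definition stage_const : R :=
  (8 / beta + 1) * (2 * (12 / (beta * (1 - beta)) + 2)).

Definition stage_budget rho : R := stage_const * B%:R * (1 + L / rho).

(** Calls before a stage that is preceded by h gap halvings and j halvings of
    rho; L * (2 ^+ j - 1) / rho1 is the sum of L / (rho1 / 2^i) over i < j. *)
Definition total_budget h j : R :=
  1 + h%:R * stage_budget (mu / 2) +
  stage_const * B%:R * (j%:R + L * (2 ^+ j - 1) / rho1).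

Lemma B_ge1 : 1 <= B%:R :> R.
Proof. by rewrite ler1n (leq_trans k_gt0). Qed.

Lemma stage_const_ge1 : 1 <= stage_const.
Proof.
have /andP[b0 b1] := beta01.
have p1 : 0 <= 8 / beta by rewrite divr_ge0 // ltW.
have p2 : 0 <= 12 / (beta * (1 - beta)).
  by rewrite divr_ge0 // mulr_ge0 ?(ltW b0) // subr_ge0 ltW.
have := mulr_ge0 p1 p2; rewrite /stage_const; lra.
Qed.

Lemma stage_cost_le rho : 0 < rho ->
  (8 / beta + 1) * center_budget rho <= stage_budget rho.
Proof.
move=> r0; have /andP[b0 b1] := beta01; have L0 := L_gt0.
have b1' : 0 < 1 - beta by lra.
rewrite /stage_budget /stage_const -!mulrA ler_pM2l; last first.
  by rewrite addr_gt0 // divr_gt0.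
rewrite /center_budget.
have -> : 12 / beta / null_rate rho L beta =
  12 / (beta * (1 - beta)) * (L / rho).
  by rewrite /null_rate; field; rewrite !gt_eqF.
set e := 12 / _; set l := L / rho.
have e0 : 0 <= e by rewrite divr_ge0 // mulr_ge0 // ltW.
have l0 : 0 <= l by rewrite divr_ge0 // ltW.
have B1 := B_ge1.
rewrite -[B.+1%:R]natr1; move: (B%:R : R) e l B1 e0 l0 => b e l B1 e0 l0.
have h1 : (e * l + 2) * (b + 1) <= (e * l + 2) * (2 * b).
  by rewrite ler_wpM2l ?addr_ge0 ?mulr_ge0 //; lra.
have h2 : (e * l + 2) * (2 * b) <= ((e + 2) * (1 + l)) * (2 * b).
  by rewrite ler_wpM2r //; lra.
apply: (le_trans h1); apply: (le_trans h2); lra.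
Qed.

Lemma stage_budget_anti rho rho' : 0 < rho <= rho' ->
  stage_budget rho' <= stage_budget rho.
Proof.
move=> /andP[r0 le_r]; rewrite /stage_budget ler_wpM2l //.
  by have := stage_const_ge1; have := B_ge1 => *; rewrite mulr_ge0 //; lra.
rewrite lerD2l ler_pM2l //.
by rewrite lef_pV2 // posrE; apply: lt_le_trans le_r.
Qed.

Lemma total_budget_halving h j i rho : mu / 2 < rho ->
  total_budget h j + stage_budget rho <= total_budget h.+1 (j + i).
Proof.
move=> lt_rho; have mu0 := mu_gt0; have r10 : 0 < rho1 by have := le_rho1; lra.
have : stage_budget rho <= stage_budget (mu / 2).
  by apply: stage_budget_anti; rewrite (ltW lt_rho) andbT; lra.
have c0 : 0 <= stage_const * B%:R.
  by have := stage_const_ge1; have := B_ge1 => *; rewrite mulr_ge0 //; lra.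
rewrite /total_budget -natr1 natrD exprD.
have : 0 <= stage_const * B%:R * (i%:R + L * (2 ^+ j * (2 ^+ i - 1)) / rho1).
  rewrite mulr_ge0 // addr_ge0 // divr_ge0 ?(ltW r10) //.
  rewrite mulr_ge0 ?(ltW L_gt0) // mulr_ge0 ?exprn_ge0 // subr_ge0.
  by rewrite exprn_ege1 // ler1n.
lra.
Qed.

Lemma total_budget_doubling h j i : (0 < i)%N ->
  total_budget h j + stage_budget (rho1 / 2 ^+ j) <= total_budget h (j + i).
Proof.
move=> i0; have mu0 := mu_gt0; have r10 : 0 < rho1 by have := le_rho1; lra.
have c0 : 0 <= stage_const * B%:R.
  by have := stage_const_ge1; have := B_ge1 => *; rewrite mulr_ge0 //; lra.
rewrite /total_budget /stage_budget natrD exprD -addrA lerD2l -mulrDr.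
rewrite ler_wpM2l //.
have -> : L / (rho1 / 2 ^+ j) = L * 2 ^+ j / rho1.
  by rewrite invfM invrK mulrA mulrAC.
have i1 : 1 <= i%:R :> R by rewrite ler1n.
have i2 : 2 <= 2 ^+ i :> R.
  rewrite -(prednK i0) exprS.
  by have : 1 <= 2 ^+ i.-1 :> R by [rewrite exprn_ege1 // ler1n]; lra.
have : 0 <= L * 2 ^+ j / rho1 * (2 ^+ i - 2).
  rewrite mulr_ge0 ?subr_ge0 // divr_ge0 ?(ltW r10) //.
  by rewrite mulr_ge0 ?exprn_ge0 // ltW.
lra.
Qed.

(** * Invariants of a run *)

(** Here h counts the stages ended by the gap test and j the halvings of rho. *)
Record stage_invariant h j s : Prop := StageInvariant {
  xbar_in : X (st_xbar s);
  psibar_model : model (st_psibar s);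
  psibar_le : minorant X f (st_psibar s);
  gapbar_cert :
    certified X f (st_rho s) (st_xbar s) (st_psibar s) (st_gapbar s);
  rho_eq : st_rho s = rho1 / 2 ^+ j;
  rho_gt : mu / 2 < st_rho s;
  gapbar_halved : st_gapbar s * st_rho s <= enorm (g x0) ^+ 2 / 2 / 2 ^+ h;
  low_eq : st_low s = f (st_xbar s) - 4 * st_gapbar s;
  low_le : st_low s <= st_best s;
  best_ge : fmin <= st_best s }.

(** Here sg counts the serious steps of the stage, q the completed blocks of
    null steps at the current center, and D bounds the gap at the start of the
    current block. *)
Record inner_invariant sg q D s : Prop := InnerInvariant {
  z_in : X (st_z s);
  psi_model : model (st_psi s);
  psi_le : minorant X f (st_psi s);
  best_le : st_best s <= f (st_z s);
  descent : f (st_z s) <= f (st_xbar s) - sg%:R * (beta / 2 * st_gapbar s);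
  block_inv :
    block X f g (st_rho s) (st_z s) L P beta (st_psi s) D (st_counter s);
  block_gap :
    D * (1 + null_rate (st_rho s) L beta) ^+ q <= 6 / beta * st_gapbar s;
  blocks_le : q%:R <= 12 / beta / null_rate (st_rho s) L beta + 1;
  counter_le : (st_counter s <= B)%N }.

Definition within_budget h j sg q s : Prop :=
  (st_calls s)%:R <= total_budget h j + sg%:R * center_budget (st_rho s) +
    (q * B.+1 + st_counter s)%:R.

(** Minimality of the doubling exponent d is what keeps rho above mu / 2: if
    d > 0 then the coefficient 2 rho / 2^d was rejected, and it would have been
    accepted if it were at most mu. *)
Lemma next_stage_invariant h j xb psib gap best rho (calls : nat) :
  X xb -> model psib -> minorant X f psib -> certified X f rho xb psib gap ->
  rho = rho1 / 2 ^+ j -> mu / 2 < rho ->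
  gap * rho <= enorm (g x0) ^+ 2 / 2 / 2 ^+ h -> fmin <= best -> best <= f xb ->
  let s := next_stage f xb psib gap best rho calls in
  exists i, [/\ best < f xb - 4 * gap -> (0 < i)%N,
    stage_invariant h (j + i) s & inner_invariant 0 0 (st_gapbar s) s].
Proof.
move=> Xb mb lb cert rhoE rho_lt halved ge_min le_f s.
have mu0 := mu_gt0; have /andP[b0 b1] := beta01.
pose ok i := f xb - 4 * 2 ^+ i * gap <= best.
have pow_ge1 i : 1 <= 2 ^+ i :> R by rewrite exprn_ege1 // ler1n.
have certi i := certified_scale cX Xb mb lb (pow_ge1 i) cert.
(* Once rho / 2^i drops below mu, the error bound gives f xb - 4 * 2^i * gap
   <= min f. *)
have ok_small i : rho / 2 ^+ i <= mu -> ok i.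
  move=> le_mu; rewrite /ok; apply: le_trans ge_min.
  have certm := certified_le le_mu (lexx _) (fun x _ => lexx (psib x))
    (certi i).
  have half : mu / 2 <= mu by lra.
  have := certified_error_bound g_sub argmin0 mu_gt0 growth_mu cX Xb lb
    half certm.
  have -> : 4 * mu * (2 ^+ i * gap) = mu * (4 * 2 ^+ i * gap) by ring.
  by rewrite ler_pM2l // -/fmin; lra.
have ok_ex : exists i, ok i.
  have r_ge0 : 0 <= rho / mu by rewrite divr_ge0 //; lra.
  exists (Num.bound (rho / mu)); apply: ok_small.
  rewrite ler_pdivrMr ?exprn_gt0 // mulrC -ler_pdivrMr //.
  apply: ltW; apply: lt_trans (archi_boundP r_ge0) _.
  by rewrite -natrX ltr_nat ltn_expl.
have [okd mind] : ok (doubling_exponent f xb gap best) /\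
    forall i, ok i -> (doubling_exponent f xb gap best <= i)%N.
  apply: (@xgetPex _ 0%N [set i | ok i /\ forall i', ok i' -> (i <= i')%N]).
  by have [m okm mmin] := ex_minnP ok_ex; exists m.
set d := doubling_exponent f xb gap best in okd mind.
exists d; rewrite /s /next_stage -/d.
have gap0 := certified_ge0 Xb lb (certi d).
split.
- by case: (d) okd => // ; rewrite /ok expr0 mulr1; lra.
- split=> //=.
  + by rewrite rhoE exprD invfM mulrA.
  + case: (d) mind => [|i] mind; first by rewrite expr0 divr1.
    rewrite ltNge; apply/negP => le_half.
    have : ok i.
      apply: ok_small; move: le_half; rewrite exprS invfM mulrCA mulrC.
      by rewrite ler_pM2r ?invr_gt0.
    by move/mind; rewrite ltnn.
  + suff -> : 2 ^+ d * gap * (rho / 2 ^+ d) = gap * rho by [].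
    by field; rewrite expf_neq0 // gt_eqF.
  + by move: okd; rewrite /ok; lra.
- split=> //=.
  + by rewrite mul0r subr0.
  + by apply: block_start; exact: certi.
  + rewrite expr0 mulr1; have : 1 <= 6 / beta by rewrite ler_pdivlMr //; lra.
    exact: ler_peMl.
  + rewrite addr_ge0 // divr_ge0 //; first by rewrite divr_ge0 // ltW.
    by apply/ltW/null_rate_gt0 => //; rewrite divr_gt0 ?exprn_gt0 //; lra.
Qed.

Lemma bernoulli_le (c : R) m : 0 <= c -> 1 + m%:R * c <= (1 + c) ^+ m.
Proof.
move=> c0; elim: m => [|m IH]; first by rewrite mul0r addr0.
rewrite exprS -[m.+1%:R]natr1.
have : (1 + c) * (1 + m%:R * c) <= (1 + c) * (1 + c) ^+ m.
  by rewrite ler_wpM2l // addr_ge0.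
have : 0 <= m%:R * c * c by rewrite !mulr_ge0.
lra.
Qed.

Lemma rho_gt0 h j s : stage_invariant h j s -> 0 < st_rho s.
Proof. by have mu0 := mu_gt0; case=> *; lra. Qed.

Lemma gapbar_gt0 h j s : stage_invariant h j s ->
  fmin < f (st_xbar s) -> 0 < st_gapbar s.
Proof.
move=> st lt_f; have r0 := rho_gt0 st; have mu0 := mu_gt0.
have := certified_error_bound g_sub argmin0 mu_gt0 growth_mu cX (xbar_in st)
  (psibar_le st) (ltW (rho_gt st)) (gapbar_cert st).
rewrite -/fmin => le_gap.
have : 0 < mu * (f (st_xbar s) - fmin) by rewrite mulr_gt0 // subr_gt0.
move=> /lt_le_trans /(_ le_gap); rewrite pmulr_rgt0 //; lra.
Qed.

Lemma center_cost sg q D s : inner_invariant sg q D s ->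
  (q * B.+1 + st_counter s).+1%:R <= center_budget (st_rho s).
Proof.
move=> inn; apply: (@le_trans _ _ ((q.+1 * B.+1)%:R)).
  by rewrite ler_nat mulSn addnC -addSn leq_add2r ltnS; exact: counter_le inn.
rewrite natrM -[q.+1%:R]natr1 ler_wpM2r //; have := blocks_le inn; lra.
Qed.

(** Each serious step decreases f by at least beta gapbar / 2, while the best
   value stays above f xbar - 4 gapbar. *)
Lemma serious_count h j sg q D s : stage_invariant h j s ->
  inner_invariant sg q D s -> 0 < st_gapbar s -> sg%:R <= 8 / beta.
Proof.
move=> st inn gap0; have /andP[b0 b1] := beta01.
have := low_le st; rewrite (low_eq st).
have := best_le inn; have := descent inn.
rewrite ler_pdivlMr // => h1 h2 h3.
have : sg%:R * beta * st_gapbar s <= 8 * st_gapbar s by lra.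
by rewrite (ler_pM2r gap0).
Qed.

Lemma stage_spent h j sg q D s : stage_invariant h j s ->
  inner_invariant sg q D s -> 0 < st_gapbar s -> within_budget h j sg q s ->
  (st_calls s).+1%:R <= total_budget h j + stage_budget (st_rho s).
Proof.
move=> st inn gap0 bud; have := serious_count st inn gap0.
have := center_cost inn; have := stage_cost_le (rho_gt0 st).
move: bud; rewrite /within_budget -[(st_calls s).+1%:R]natr1.
rewrite -[(_ + st_counter s).+1%:R]natr1.
have : 0 <= center_budget (st_rho s) := le_trans (ler0n _ _) (center_cost inn).
move: (center_budget _) => cb cb0 h1 h2 h3 h4.
have : sg%:R * cb <= 8 / beta * cb by rewrite ler_wpM2r.
lra.
Qed.

Lemma stage_null_rate_gt0 h j s : stage_invariant h j s ->
  0 < null_rate (st_rho s) L beta.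
Proof. by move=> st; apply: null_rate_gt0 => //; exact: rho_gt0 st. Qed.

Lemma rlm_step_invariant h j sg q D s : stage_invariant h j s ->
  inner_invariant sg q D s -> within_budget h j sg q s ->
  fmin < f (st_xbar s) ->
  exists h' j' sg' q' D', let s' := rlm_step X f g beta B s in
    [/\ stage_invariant h' j' s', inner_invariant sg' q' D' s' &
        within_budget h' j' sg' q' s'].
Proof.
move=> st inn bud lt_f; have gapbar0 := gapbar_gt0 st lt_f.
have r0 := rho_gt0 st; have c0 := stage_null_rate_gt0 st; have mu0 := mu_gt0.
have spent := stage_spent st inn gapbar0 bud.
have /andP[b0 b1] := beta01.
have [Xz mpsi lpsi] := And3 (z_in inn) (psi_model inn) (psi_le inn).
rewrite /rlm_step /one_step /=.
set rho := st_rho s in r0 c0 spent *; set z := st_z s in Xz *.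
set psi := st_psi s in mpsi lpsi *.
set y := prox_point X rho psi z; set gap := f z - psi y - _.
have Xy : X y := prox_in clX Xz r0 mpsi.
have ge_min' : fmin <= Num.min (st_best s) (f y).
  by rewrite le_min (best_ge st) min_value_le.
have le_best : Num.min (st_best s) (f y) <= f z.
  by rewrite ge_min (best_le inn).
have f_z_xbar : f z <= f (st_xbar s).
  apply: le_trans (descent inn) _; rewrite gerDl oppr_le0 mulr_ge0 //.
  by rewrite mulr_ge0 ?(ltW gapbar0) // divr_ge0 // ltW.
have gap_v : gap <= f z - psi y := gap_le_decrease X f z psi r0.
have mcut := model_cutting_plane psi rho z y.
have cutle x : X x -> cutting_plane psi rho z y x <= psi x.
  exact: cut_le.
have lcut : minorant X f (cutting_plane psi rho z y).
  by move=> x Xx; exact: le_trans (cutle x Xx) (lpsi x Xx).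
have mlin u : model (linearization f g u) := model_linearization f g u.
have llin u (Xu : X u) := minorant_linearization g_sub Xu.
case: ifPn => [exit_low|].
  have [i [i0 st' inn']] := next_stage_invariant (st_calls s).+1 (xbar_in st)
    (psibar_model st) (psibar_le st) (gapbar_cert st) (rho_eq st) (rho_gt st)
    (gapbar_halved st) ge_min' (le_trans le_best f_z_xbar).
  exists h, (j + i)%N, 0%N, 0%N; eexists; split; [exact: st'|exact: inn'|].
  rewrite /within_budget /= mul0r mul0n !addr0.
  apply: le_trans spent _; rewrite /rho (rho_eq st).
  apply: total_budget_doubling.
  by apply: i0; rewrite -(low_eq st).
rewrite -leNgt => low_le'.
case: ifPn => [exit_gap|].
  set psi' := fun x => Num.max _ (Num.max _ _).
  have mpsi' : model psi' by apply: model_max => //; apply: model_max.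
  have lpsi' : minorant X f psi'.
    by apply: minorant_max => //; apply: minorant_max; exact: llin.
  have cert' : certified X f rho z psi' gap.
    by apply: certified_cut => // x _; rewrite le_max lexx.
  have halved : gap * rho <= enorm (g x0) ^+ 2 / 2 / 2 ^+ h.+1.
    have := gapbar_halved st; rewrite -/rho [2 ^+ h.+1]exprS invfM.
    have : gap * rho <= st_gapbar s / 2 * rho by rewrite ler_wpM2r // ltW.
    lra.
  have [i [_ st' inn']] := next_stage_invariant (st_calls s).+1 Xz mpsi' lpsi'
    cert' (rho_eq st) (rho_gt st) halved ge_min' le_best.
  exists h.+1, (j + i)%N, 0%N, 0%N; eexists; split; [exact: st'|exact: inn'|].
  rewrite /within_budget /= mul0r mul0n !addr0.
  by apply: le_trans spent _; apply: total_budget_halving; exact: rho_gt st.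
rewrite -ltNge => gap_big.
have st' z' psi' b' calls' : stage_invariant h j
    {| st_xbar := st_xbar s; st_psibar := st_psibar s; st_gapbar := st_gapbar s;
       st_best := Num.min (st_best s) (f y); st_low := st_low s; st_rho := rho;
       st_z := z'; st_psi := psi'; st_counter := b'; st_calls := calls' |}.
  by case: st => *; split.
have blk := block_inv inn; rewrite -/rho -/z -/psi in blk.
have [serious|] := boolP (beta * (f z - psi y) <= f z - f y).
  have v_le : beta * (f z - psi y) <= 4 * st_gapbar s.
    have : st_low s <= f y.
      by apply: le_trans low_le' _; rewrite ge_min lexx orbT.
    rewrite (low_eq st); lra.
  exists h, j, sg.+1, 0%N, (6 / beta * st_gapbar s); split; first exact: st'.
    split => //=.
    - by apply: model_max => //; apply: model_max.
    - by apply: minorant_max => //; apply: minorant_max; exact: llin.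
    - by rewrite ge_min lexx orbT.
    - have := descent inn; rewrite -/z -[sg.+1%:R]natr1.
      have : beta * gap <= beta * (f z - psi y) by rewrite ler_pM2l.
      have : beta * (st_gapbar s / 2) <= beta * gap by rewrite ler_pM2l // ltW.
      lra.
    - apply: block_start.
      have le_fy : f y <= f z.
        have : 0 <= beta * (f z - psi y) by rewrite mulr_ge0 ?(ltW b0) //; lra.
        lra.
      apply: (certified_le (lexx rho) _ (fun x _ => lexx _)); last first.
        by apply: (certified_serious clX cX Xz r0 mpsi lpsi le_fy) => x _;
          rewrite le_max lexx.
      have : f z - psi y <= 4 * st_gapbar s / beta.
        by rewrite ler_pdivlMr // mulrC.
      lra.
    - by rewrite expr0 mulr1.
    - by rewrite addr_ge0 // divr_ge0 ?(ltW c0) // divr_ge0 // ltW.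
  rewrite /within_budget /= -[(st_calls s).+1%:R]natr1 -[sg.+1%:R]natr1.
  rewrite mul0n addn0.
  have := center_cost inn; move: bud; rewrite /within_budget -/rho.
  rewrite -[(_ + _).+1%:R]natr1; lra.
rewrite -ltNge => null.
rewrite /=; case: eqP => [b_eq|b_neq] /=.
  have contr : gap <= D / (1 + null_rate rho L beta).
    apply: (null_step_contract _ _ _ _ _ _ _ _ _ null blk) => //.
    by rewrite b_eq.
  exists h, j, sg, q.+1, (D / (1 + null_rate rho L beta)).
  split; first exact: st'.
    split => //=.
    - by apply: model_max => //; apply: model_max.
    - by apply: minorant_max => //; apply: minorant_max; exact: llin.
    - exact: descent inn.
    - apply: block_start.
      apply: (certified_le (lexx rho) contr (fun x _ => lexx _)).
      by apply: certified_cut => // x _; rewrite le_max lexx.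
    - have := block_gap inn; rewrite -/rho exprS mulrA mulfVK //.
      by rewrite gt_eqF // addr_gt0.
    - have D_big : st_gapbar s / 2 < D.
        apply: lt_le_trans gap_big _; exact: certified_gap_le blk.1.
      (* Bernoulli's inequality bounds the number q of earlier contractions. *)
      have q_c : q%:R * null_rate rho L beta <= 12 / beta.
        have bern := bernoulli_le q (ltW c0).
        have : st_gapbar s / 2 * (1 + null_rate rho L beta) ^+ q <=
            6 / beta * st_gapbar s.
          apply: le_trans (block_gap inn).
          rewrite -/rho ler_wpM2r ?(ltW D_big) //.
          by rewrite exprn_ge0 // addr_ge0 // ltW.
        rewrite mulrAC [_ * st_gapbar s]mulrC -mulrA ler_pM2l //.
        lra.
      by rewrite -[q.+1%:R]natr1 lerD2r ler_pdivlMr.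
  rewrite /within_budget /= addn0 mulSnr addnS -[(_ + _).+1%:R]natr1.
  rewrite -[(st_calls s).+1%:R]natr1.
  by have := bud; rewrite /within_budget -/rho b_eq; lra.
exists h, j, sg, q, D; split; first exact: st'.
  split => //=.
  - by apply: model_max.
  - by apply: minorant_max => //; exact: llin.
  - exact: descent inn.
  - apply: (null_step_block (psi := psi)) => //.
    + by move=> x _; rewrite le_max lexx.
    + by move=> x _; rewrite le_max lexx orbT.
  - exact: block_gap inn.
  - exact: blocks_le inn.
  - by rewrite ltn_neqAle (counter_le inn) andbT; apply/eqP.
rewrite /within_budget /= addnS -[(st_calls s).+1%:R]natr1.
rewrite -[(_ + _).+1%:R]natr1.
by have := bud; rewrite /within_budget -/rho; lra.
Qed.

(** * The complexity bound *)

(** For the linearization at x0, the certificate value over the whole space is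
    |g x0|^2 / (2 rho1), which bounds the one over X. *)
Lemma rlm_init_certificate :
  let psi := linearization f g x0 in
  certified X f rho1 x0 psi (certificate X f rho1 x0 psi) /\
  certificate X f rho1 x0 psi * rho1 <= enorm (g x0) ^+ 2 / 2.
Proof.
move=> psi; have r10 : 0 < rho1 by have mu0 := mu_gt0; have := le_rho1; lra.
have bound x : X x -> f x0 - psi x - rho1 / 2 * enorm (x - x0) ^+ 2 <=
    enorm (g x0) ^+ 2 / (2 * rho1).
  move=> _; rewrite /psi /linearization !enorm_sq.
  by have := young (g x0) (x - x0) r10; lra.
split.
  move=> x Xx; rewrite lerBlDr addrC -!lerBlDr.
  pose S := [set f x0 - psi x - rho1 / 2 * enorm (x - x0) ^+ 2 | x in X].
  have ub : has_ubound S.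
    by exists (enorm (g x0) ^+ 2 / (2 * rho1)) => _ [w Xw <-]; exact: bound.
  have /(ub_le_sup ub) : S (f x0 - psi x - rho1 / 2 * enorm (x - x0) ^+ 2).
    by exists x.
  rewrite -/(certificate X f rho1 x0 psi); lra.
have : certificate X f rho1 x0 psi <= enorm (g x0) ^+ 2 / (2 * rho1).
  apply: ge_sup.
    by exists (f x0 - psi x0 - rho1 / 2 * enorm (x0 - x0) ^+ 2), x0.
  by move=> _ [w Xw <-]; exact: bound.
by rewrite invfM mulrA ler_pdivlMr.
Qed.

Lemma rlm_init_invariant : let s := rlm_init X f g x0 rho1 in
  [/\ stage_invariant 0 0 s, inner_invariant 0 0 (st_gapbar s) s &
      within_budget 0 0 0 0 s].
Proof.
have [cert halved] := rlm_init_certificate.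
have mu0 := mu_gt0; have le_r := le_rho1; have /andP[b0 b1] := beta01.
have mlin := model_linearization f g x0.
have llin : minorant X f (linearization f g x0) :=
  minorant_linearization g_sub Xx0.
have gap0 := certified_ge0 Xx0 llin cert.
split.
- split=> //=; rewrite ?expr0 ?divr1 //; first lra.
  + by rewrite gerBl mulr_ge0.
  + exact: min_value_le.
- split=> //=.
  + by rewrite mul0r subr0.
  + exact: block_start.
  + rewrite expr0 mulr1; have : 1 <= 6 / beta by rewrite ler_pdivlMr //; lra.
    exact: ler_peMl.
  + have c0 : 0 < null_rate rho1 L beta by apply: null_rate_gt0 => //; lra.
    by rewrite addr_ge0 // divr_ge0 ?(ltW c0) // divr_ge0 // ltW.
- rewrite /within_budget /total_budget /= expr0 subrr.
  by rewrite !(mul0r, mulr0, addr0).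
Qed.

Lemma rlm_step_calls s : st_calls (rlm_step X f g beta B s) = (st_calls s).+1.
Proof. by rewrite /rlm_step; do 2 case: ifP => // _. Qed.

Lemma rlm_calls T : st_calls (rlm_pbm X f g x0 rho1 beta B T) = T.+1.
Proof.
elim: T => // T IH; rewrite /rlm_pbm iterS rlm_step_calls.
by rewrite -/(rlm_pbm _ _ _ _ _ _ _ T) IH.
Qed.

Lemma rlm_invariant T :
  (forall T', (T' < T)%N ->
    fmin < f (st_xbar (rlm_pbm X f g x0 rho1 beta B T'))) ->
  exists h j sg q D, let s := rlm_pbm X f g x0 rho1 beta B T in
    [/\ stage_invariant h j s, inner_invariant sg q D s &
        within_budget h j sg q s].
Proof.
elim: T => [_|T IH lt_f].
  by exists 0%N, 0%N, 0%N, 0%N; eexists; exact: rlm_init_invariant.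
have [|h [j [sg [q [D [st inn bud]]]]]] := IH.
  by move=> T' ltT; apply: lt_f; apply: ltn_trans ltT _.
exact: rlm_step_invariant st inn bud (lt_f T (ltnSn T)).
Qed.

Lemma pow2_log_plus m (a : R) : 2 ^+ m < 2 * a ->
  m%:R <= 1 + log_plus a / ln 2.
Proof.
move=> lt_a; have a0 : 0 < a.
  by have : 0 < 2 ^+ m :> R by [rewrite exprn_gt0]; lra.
have l2 : 0 < ln 2 :> R by rewrite ln_gt0 // ltr1n.
have : ln (2 ^+ m) <= ln (2 * a).
  by rewrite ler_ln ?posrE ?exprn_gt0 ?mulr_gt0 // ltW.
rewrite lnXn // lnM ?posrE // -[ln 2 *+ m]mulr_natl => le_ln.
have : ln a <= log_plus a.
  by rewrite ler_ln ?posrE // ?lt_max ?ltr01 // le_max lexx orbT.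
have -> : 1 + log_plus a / ln 2 = (ln 2 + log_plus a) / ln 2.
  by rewrite mulrDl mulfV // gt_eqF.
rewrite ler_pdivlMr //; lra.
Qed.

Lemma log_plus_ge0 (a : R) : 0 <= log_plus a.
Proof. by rewrite ln_ge0 // le_max lexx. Qed.

Definition complexity_const : R := 1 + 7 * stage_const + 2 * stage_const / ln 2.

(** As long as the error exceeds eps, the error bound forces
    2^h < 2 |g x0|^2 / (mu eps), and rho > mu / 2 forces 2^j < 2 rho1 / mu. *)
Lemma spent_before_accuracy h j sg q D s (eps : R) : stage_invariant h j s ->
  inner_invariant sg q D s -> within_budget h j sg q s -> 0 < eps ->
  eps < f (st_xbar s) - fmin ->
  (st_calls s).+1%:R <= complexity_const *
     (B%:R * (1 + L / mu) * (1 + log_plus (enorm (g x0) ^+ 2 / (mu * eps))) +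
      B%:R * log_plus (rho1 / mu)).
Proof.
move=> st inn bud eps0 lt_eps; have mu0 := mu_gt0; have L0 := L_gt0.
have r10 : 0 < rho1 by have := le_rho1; lra.
have lt_f : fmin < f (st_xbar s) by lra.
have spent := stage_spent st inn (gapbar_gt0 st lt_f) bud.
have p2 i : 0 < 2 ^+ i :> R by rewrite exprn_gt0.
have l2 : 0 < ln 2 :> R by rewrite ln_gt0 // ltr1n.
have h_le : h%:R <= 1 + log_plus (enorm (g x0) ^+ 2 / (mu * eps)) / ln 2.
  apply: pow2_log_plus; rewrite mulrA ltr_pdivlMr ?mulr_gt0 //.
  have := certified_error_bound g_sub argmin0 mu_gt0 growth_mu cX (xbar_in st)
    (psibar_le st) (ltW (rho_gt st)) (gapbar_cert st).
  have := gapbar_halved st; rewrite ler_pdivlMr // -/fmin => h1 h2.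
  have : mu * eps < 4 * st_rho s * st_gapbar s.
    by apply: lt_le_trans h2; rewrite ltr_pM2l.
  rewrite -(ltr_pM2r (p2 h)); lra.
have j_le : j%:R <= 1 + log_plus (rho1 / mu) / ln 2.
  apply: pow2_log_plus; rewrite mulrA ltr_pdivlMr //.
  have := rho_gt st; rewrite (rho_eq st) ltr_pdivlMr //; lra.
have rho_inv : L * (2 ^+ j - 1) / rho1 <= 2 * (L / mu).
  have : L / st_rho s <= L / (mu / 2).
    rewrite ler_pM2l // lef_pV2 ?posrE ?(ltW (rho_gt st)) ?divr_gt0 //.
    exact: rho_gt0 st.
  rewrite (rho_eq st) !invfM !invrK.
  have : 0 <= L / rho1 by rewrite divr_ge0 // ltW.
  lra.
have sb_le : stage_budget (st_rho s) <= stage_budget (mu / 2).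
  by apply: stage_budget_anti; rewrite (ltW (rho_gt st)) andbT; lra.
apply: (le_trans spent); move: sb_le; rewrite /total_budget.
have -> : stage_budget (mu / 2) = stage_const * B%:R * (1 + 2 * (L / mu)).
  by rewrite /stage_budget invfM invrK; congr (_ * (1 + _)); ring.
move: (stage_budget _) => sb.
have lp0 := log_plus_ge0 (enorm (g x0) ^+ 2 / (mu * eps)).
have lq0 := log_plus_ge0 (rho1 / mu).
have A1 := stage_const_ge1; have B1 := B_ge1.
have l0 : 0 <= L / mu by rewrite divr_ge0 // ltW.
rewrite /complexity_const.
move: (log_plus _) (log_plus _) lp0 lq0 h_le j_le => lq lp lp0 lq0 h_le j_le.
have iv : 0 <= (ln 2)^-1 :> R by rewrite invr_ge0 ltW.
move: (ln 2)^-1 iv h_le j_le => v v0 h_le j_le.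
move: (L * _ / rho1) rho_inv => w w_le.
move: stage_const (B%:R) (L / mu) A1 B1 l0 w_le => A b l A1 b1 l0 w_le.
move: (h%:R : R) (j%:R : R) h_le j_le => hr jr h_le j_le sb_le.
have Ab0 : 0 <= A * b by rewrite mulr_ge0; lra.
have t1 : hr * (A * b * (1 + 2 * l)) <= (1 + lp * v) * (A * b * (1 + 2 * l)).
  by rewrite ler_wpM2r // mulr_ge0 //; lra.
have t2 : A * b * (jr + w) <= A * b * (1 + lq * v + 2 * l).
  by rewrite ler_wpM2l //; lra.
have nn (x y : R) : 0 <= x -> 0 <= y -> 0 <= x * y by exact: mulr_ge0.
have b0 : 0 <= b by lra.
have p0 := nn _ _ b0 l0.
have r0 : 0 <= b * (1 + l) * lp + b * lq.
  by rewrite addr_ge0 // !nn //; lra.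
have A0 : 0 <= A by lra.
have := nn _ _ A0 r0; have := nn _ _ A0 p0.
have : 0 <= A * v * (b * (1 + l)) by rewrite !nn //; lra.
have := nn _ _ Ab0 (nn _ _ lp0 v0); have := nn _ _ Ab0 (nn _ _ lq0 v0).
lra.
Qed.

(** The first accurate iterate: its predecessors are all inaccurate, so the
    budget holds for it; such an iterate exists because each iteration makes one
    call. *)
Lemma rlm_complexity (eps : R) : 0 < eps < f x0 - fmin ->
  exists T : nat, let s := rlm_pbm X f g x0 rho1 beta B T in
    [/\ X (st_xbar s), f (st_xbar s) - fmin <= eps &
        (st_calls s)%:R <= complexity_const *
          (B%:R * (1 + L / mu)
             * (1 + log_plus (enorm (g x0) ^+ 2 / (mu * eps))) +
           B%:R * log_plus (rho1 / mu))].
Proof.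
move=> /andP[eps0 eps_lt]; set bound := complexity_const * _.
pose gap T := f (st_xbar (rlm_pbm X f g x0 rho1 beta B T)) - fmin.
have inv T : (forall T', (T' < T)%N -> eps < gap T') ->
  exists h j sg q D, let s := rlm_pbm X f g x0 rho1 beta B T in
    [/\ stage_invariant h j s, inner_invariant sg q D s &
        within_budget h j sg q s].
  by move=> big; apply: rlm_invariant => T' /big; rewrite /gap; lra.
have spent T : (forall T', (T' <= T)%N -> eps < gap T') -> T.+2%:R <= bound.
  move=> big; have [|h [j [sg [q [D [st inn bud]]]]]] := inv T.
    by move=> T' /ltnW; exact: big.
  have := spent_before_accuracy st inn bud eps0 (big T (leqnn T)).
  by rewrite rlm_calls.
have ex_good : exists T, gap T <= eps.
  apply: contrapT => nogood.
  have big T : eps < gap T.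
    by rewrite ltNge; apply/negP => le; apply: nogood; exists T.
  have := spent (Num.bound bound) (fun T' _ => big T').
  have b0 : 0 <= bound by apply: le_trans (spent 0%N (fun T' _ => big T')).
  have := archi_boundP b0 => lt_b; rewrite leNgt => /negP; apply.
  by apply: lt_trans lt_b _; rewrite ltr_nat.
have [[|T] good Tmin] := ex_minnP ex_good.
  by move: good; rewrite /gap /=; lra.
have big T' : (T' < T.+1)%N -> eps < gap T'.
  by rewrite ltnNge => ltT; rewrite ltNge; apply: contra ltT => /Tmin.
exists T.+1; split=> //; last by rewrite rlm_calls; exact: spent.
by have [h [j [sg [q [D [st _ _]]]]]] := inv T.+1 big; exact: xbar_in st.
Qed.

End Complexity.

Theorem theorem6p2 (R : realType) (beta : R) (hbeta : 0 < beta < 1) :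
  exists C : R, 0 < C /\
  forall (n : nat) (X : set 'rV[R]_n) (f : 'rV[R]_n -> R)
    (g : 'rV[R]_n -> 'rV[R]_n) (k : nat) (L : R)
    (P : 'I_k -> set 'rV[R]_n) (mu : R)
    (x0 : 'rV[R]_n) (B : nat) (rho1 eps : R),
  X !=set0 -> closed X -> convex_set X ->
  convex_function X f -> lsc_on X f ->
  argmin_on X f !=set0 ->
  (forall u, X u -> subdifferential X f u (g u)) ->
  (0 < k)%N -> 0 < L ->
  piecewise_smooth X L P f ->
  piecewise_oracle_bound L P f g ->
  growth_modulus X f = mu%:E -> 0 < mu ->
  X x0 -> (k <= B)%N -> mu <= rho1 ->
  0 < eps < f x0 - min_value X f ->
  exists T : nat,
    let s := rlm_pbm X f g x0 rho1 beta B T in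
    [/\ X (st_xbar s),
        f (st_xbar s) - min_value X f <= eps &
        (st_calls s)%:R <=
          C * (B%:R * (1 + L / mu)
                 * (1 + log_plus (enorm (g x0) ^+ 2 / (mu * eps)))
               + B%:R * log_plus (rho1 / mu))].
Proof.
exists (complexity_const beta); split.
  have A1 := stage_const_ge1 hbeta.
  have l2 : 0 < ln 2 :> R by rewrite ln_gt0 // ltr1n.
  have : 0 <= 2 * stage_const beta / ln 2.
    by rewrite divr_ge0 ?(ltW l2) //; lra.
  rewrite /complexity_const; lra.
move=> n X f g k L P mu x0 B rho1 eps _ clX cX _ _ argmin0 g_sub k0 L0.
move=> [cover _] oracle growth mu0 Xx0 kB le_r.
exact: (rlm_complexity hbeta clX cX argmin0 g_sub k0 L0 cover oracle growth mu0
  Xx0 kB le_r).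
Qed.
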